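(* Let $(\mathbf{C},I)$ be a $\sigma$-effectus. Then $\mathbf{C}$ admits normalization if and only if the effect monoid $\mathbf{C}(I,I)$ of scalars is isomorphic (as an effect monoid) to $\{0\}$, to $\{0,1\}$, or to the real unit interval $[0,1]$.
   Context: Countable means finite (possibly empty) or countably infinite. A partial commutative monoid (PCM) is a set $X$ with $0\in X$ and a partial binary operation $\oplus$ with $(x\oplus y)\oplus z=x\oplus(y\oplus z)$, $x\oplus y=y\oplus x$, $0\oplus x=x$, where ''$=$'' is Kleene equality (if either side is defined, so is the other, and they are equal); $x\perp y$ means $x\oplus y$ is defined. An effect algebra is a PCM $E$ with an element $1\in E$ such that for each $a\in E$ there is a unique $a^{\perp}\in E$ with $a\oplus a^{\perp}=1$, and $a\perp 1$ implies $a=0$; it is partially ordered by $a\le b$ iff $a\oplus c=b$ for some $c$. A $\sigma$-PAM is a nonempty set $M$ with a partial operation $\bigoplus$ sending countable families $(x_j)_{j\in J}$ in $M$ to elements of $M$ (a family is summable if its sum is defined), such that: (partition-associativity) for each countable family $(x_j)_{j\in J}$ and countable partition $J=\biguplus_{k\in K}J_k$, the family is summable iff each $(x_j)_{j\in J_k}$ is summable and $(\bigoplus_{j\in J_k}x_j)_{k\in K}$ is summable, and then $\bigoplus_{j\in J}x_j=\bigoplus_{k\in K}\bigoplus_{j\in J_k}x_j$; (unary sum) one-element families are summable with sum their element; (limit) a countable family is summable whenever all its finite subfamilies are. A $\sigma$-PAM is a PCM with $x_1\oplus x_2=\bigoplus_{i\in\{1,2\}}x_i$ and $0=\bigoplus\emptyset$.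 A map between $\sigma$-PAMs is $\sigma$-additive if it sends summable families to summable families and preserves their sums; $\sigma$-biadditive means $\sigma$-additive in each argument. A $\sigma$-PAC is a category $\mathbf{C}$ with countable coproducts (coprojections $\kappa_i$), all of whose homsets are $\sigma$-PAMs with $\sigma$-biadditive composition (so there are zero morphisms $0_{AB}$), such that: (compatible sum) every compatible countable family $(f_j\colon A\to B)_{j\in J}$ is summable in $\mathbf{C}(A,B)$; (untying) if $f,g\colon A\to B$ are summable then so are $\kappa_1\circ f,\kappa_2\circ g\colon A\to B+B$. Here $(f_j\colon A\to B_j)_{j\in J}$ is compatible if there is $f\colon A\to\coprod_{j}B_j$ with $\triangleright_j\circ f=f_j$ for all $j$, where the partial projection $\triangleright_i\colon\coprod_jB_j\to B_i$ is determined by $\triangleright_i\circ\kappa_i=\mathrm{id}$ and $\triangleright_i\circ\kappa_k=0$ for $k\ne i$. A $\sigma$-effectus is a $\sigma$-PAC $\mathbf{C}$ with a distinguished object $I$ such that: (i) for each $A$, the PCM $\mathbf{C}(A,I)$ is an effect algebra, with top written $\mathbf{1}_A$; (ii) $\mathbf{1}_B\circ f=0_{AI}$ implies $f=0_{AB}$ for all $f\colon A\to B$; (iii) $\mathbf{1}_B\circ f\perp\mathbf{1}_B\circ g$ implies $f\perp g$ for all $f,g\colon A\to B$. A substate on $A$ is a morphism $\omega\colon I\to A$; it is a state if $\mathbf{1}_A\circ\omega=\mathbf{1}_I$. A scalar is a morphism $I\to I$. An effect monoid is an effect algebra with an associative total binary operation $\cdot$ that is biadditive (in each argument it preserves $0$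 and all defined sums $\oplus$) and satisfies $a\cdot1=a=1\cdot a$. The scalars $\mathbf{C}(I,I)$ form an effect monoid with $\cdot$ given by composition. On $\{0\}$, $\{0,1\}$ and $[0,1]$ the effect monoid structure is ordinary multiplication and ordinary addition, the latter defined when the sum is $\le1$ (on $\{0\}$, $1$ and $0$ coincide and $0\oplus0=0$). The $\sigma$-effectus admits normalization if for each nonzero substate $\omega\colon I\to A$ there exists a unique state $\bar\omega\colon I\to A$ with $\omega=\bar\omega\circ(\mathbf{1}_A\circ\omega)$. *)

(* Defs.v *)
From HB Require Import structures.
From mathcomp Require Import all_boot all_order all_algebra reals.

Set Implicit Arguments.
Unset Strict Implicit.
Unset Printing Implicit Defensive.

Import Order.TTheory GRing.Theory Num.Theory.

(* Conventions.  Partial operations are [option]-valued, so Kleene equality is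
   equality in [option].  A countable family is a function on a [countType].
   A partition of J into blocks J_k (possibly empty) indexed by K is given by
   the map f : J -> K sending each j to the index of its block, so that
   J_k = {j | f j == k}. *)

Record pcm := Pcm {
  pcm_sort :> Type;
  pcm0 : pcm_sort;
  pcm_add : pcm_sort -> pcm_sort -> option pcm_sort;
  pcm_addA : forall x y z,
    obind (fun s => pcm_add s z) (pcm_add x y) =
    obind (fun s => pcm_add x s) (pcm_add y z);
  pcm_addC : forall x y, pcm_add x y = pcm_add y x;
  pcm_add0 : forall x, pcm_add pcm0 x = Some x }.

Arguments pcm0 {p}.

Definition perp (X : pcm) (x y : X) : Prop := pcm_add x y <> None.

Definition effect_algebra_axiom (E : pcm) (one : E) : Prop :=
  (forall a : E, exists! b : E, pcm_add a b = Some one) /\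
  (forall a : E, perp a one -> a = pcm0).

Record effectAlgebra := EffectAlgebra {
  ea_pcm :> pcm;
  ea1 : ea_pcm;
  ea_axiom : effect_algebra_axiom ea1 }.

Arguments ea1 {e}.

Definition additive (E F : pcm) (f : E -> F) : Prop :=
  f pcm0 = pcm0 /\
  forall x y s, pcm_add x y = Some s -> pcm_add (f x) (f y) = Some (f s).

Record effectMonoid := EffectMonoid {
  em_ea :> effectAlgebra;
  em_mul : em_ea -> em_ea -> em_ea;
  em_mulA : forall a b c, em_mul a (em_mul b c) = em_mul (em_mul a b) c;
  em_additive_l : forall a, additive (fun b => em_mul b a);
  em_additive_r : forall a, additive (em_mul a);
  em_mul1 : forall a, em_mul a ea1 = a;
  em_1mul : forall a, em_mul ea1 a = a }.

Definition em_morphism (M N : effectMonoid) (f : M -> N) : Prop :=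
  [/\ additive f, f ea1 = ea1 & forall a b, f (em_mul a b) = em_mul (f a) (f b)].

Definition em_isomorphic (M N : effectMonoid) : Prop :=
  exists (f : M -> N) (g : N -> M),
    [/\ em_morphism f, em_morphism g, cancel f g & cancel g f].

Record sigmaPAM_on (M : Type) := SigmaPAMOn {
  pam_sum : forall J : countType, (J -> M) -> option M;
  pam_nonempty : inhabited M;
  pam_partition : forall (J K : countType) (f : J -> K) (x : J -> M) (s : M),
    pam_sum x = Some s <->
    exists y : K -> M,
      (forall k, pam_sum (fun j : {j : J | f j == k} => x (val j)) = Some (y k))
      /\ pam_sum y = Some s;
  pam_unary : forall (J : countType) (x : J -> M) (j0 : J),
    (forall j, j = j0) -> pam_sum x = Some (x j0);
  pam_limit : forall (J : countType) (x : J -> M),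
    (forall F : seq J, pam_sum (fun j : {j : J | j \in F} => x (val j)) <> None) ->
    pam_sum x <> None }.

Record sigmaPAM := SigmaPAM {
  pam_sort :> Type;
  pam_on : sigmaPAM_on pam_sort }.

Definition Sum (M : sigmaPAM) (J : countType) (x : J -> M) : option M :=
  pam_sum (pam_on M) x.

Definition summable (M : sigmaPAM) (J : countType) (x : J -> M) : Prop :=
  Sum x <> None.

Definition sigma_additive (M N : sigmaPAM) (f : M -> N) : Prop :=
  forall (J : countType) (x : J -> M) (s : M),
    Sum x = Some s -> Sum (fun j => f (x j)) = Some (f s).

Section SigmaPAMTheory.
Variable M : sigmaPAM.
Implicit Types J K : countType.

Definition empty_family : void -> M := of_void M.

Definition pam_add (x y : M) : option M := Sum (fun b : bool => if b then x else y).

Lemma Sum_partition J K (f : J -> K) (x : J -> M) s :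
  Sum x = Some s <->
  exists y : K -> M,
    (forall k, Sum (fun j : {j : J | f j == k} => x (val j)) = Some (y k))
    /\ Sum y = Some s.
Proof. exact: pam_partition. Qed.

Lemma Sum_unary J (x : J -> M) j0 : (forall j, j = j0) -> Sum x = Some (x j0).
Proof. exact: pam_unary. Qed.

Lemma Sum_reindex_imp J K (f : J -> K) (g : K -> J) (x : K -> M) s :
  cancel f g -> cancel g f -> Sum x = Some s -> Sum (fun j => x (f j)) = Some s.
Proof.
move=> fK gK Hx; apply/(Sum_partition f); exists x; split=> // k.
have Hk : f (g k) == k by rewrite gK.
rewrite (Sum_unary _ (j0 := exist (fun j => f j == k) (g k) Hk)) /= ?gK //.
by move=> [j e]; apply: val_inj; rewrite /= -(eqP e) fK.
Qed.

Lemma opt_ext (T : Type) (a b : option T) :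
  (forall s, a = Some s <-> b = Some s) -> a = b.
Proof.
case: a b => [a|] [b|] // H.
- by rewrite (proj1 (H a) erefl).
- by rewrite (proj1 (H a) erefl).
- by rewrite (proj2 (H b) erefl).
Qed.

Lemma Sum_ext J (x y : J -> M) : x =1 y -> Sum x = Sum y.
Proof.
suff H (u v : J -> M) s : u =1 v -> Sum u = Some s -> Sum v = Some s.
  move=> e; apply: opt_ext => s; split; apply: H => // j; exact/esym/e.
move=> e Hu; apply/(Sum_partition id); exists u; split=> // k.
rewrite (Sum_unary _ (j0 := exist (fun j => j == k) k (eqxx k))) /= ?e //.
by move=> [j e0]; apply: val_inj; rewrite /= (eqP e0).
Qed.

Lemma Sum_reindex J K (f : J -> K) (g : K -> J) (x : K -> M) :
  cancel f g -> cancel g f -> Sum (fun j => x (f j)) = Sum x.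
Proof.
move=> fK gK; apply: opt_ext => s; split; last exact: Sum_reindex_imp.
move/(Sum_reindex_imp gK fK) => <-; apply: Sum_ext => k; by rewrite gK.
Qed.

Lemma Sum_empty_summable : isSome (Sum empty_family).
Proof.
case: (pam_nonempty (pam_on M)) => x.
have /(Sum_partition (fun=> true)) [y [Hy _]] :
  Sum (fun _ : unit => x) = Some x by rewrite (Sum_unary _ (j0 := tt)) //; case.
pose e (j : {j : unit | true == false}) : void :=
  False_rect void (notF (valP j)).
have /(Sum_partition e) [z [_ Hz]] := Hy false.
by rewrite (Sum_ext (y := z)) ?Hz //; case.
Qed.

Definition pam0 : M :=
  match Sum empty_family as o return isSome o -> M with
  | Some z => fun=> z
  | None => fun H => False_rect M (notF H)
  end Sum_empty_summable.

Lemma pam0E : Sum empty_family = Some pam0.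
Proof. by rewrite /pam0; move: Sum_empty_summable; case: (Sum _). Qed.

Lemma Sum_void_like J (x : J -> M) : (J -> False) -> Sum x = Some pam0.
Proof.
move=> nJ; apply/(Sum_partition (fun j => False_rect void (nJ j))).
by exists empty_family; split; [case | exact: pam0E].
Qed.

Lemma Sum_sum J K (u : J + K -> M) s :
  Sum u = Some s <->
  exists a b, [/\ Sum (fun j => u (inl j)) = Some a,
                  Sum (fun k => u (inr k)) = Some b & pam_add a b = Some s].
Proof.
pose f (jk : J + K) : bool := if jk is inl _ then true else false.
have HT : Sum (fun j : {j | f j == true} => u (val j)) = Sum (fun j => u (inl j)).
  pose h j : {j | f j == true} := exist (fun j => f j == true) (inl j) isT.
  have h' (jk : {j | f j == true}) : {j | jk = h j}.
    case: jk => [[j|k] p] //; exists j; exact: val_inj.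
  rewrite -(@Sum_reindex _ _ h (fun jk => sval (h' jk))) //=.
  - by move=> j; case: (h' _) => j' /= [].
  - by move=> jk; case: (h' jk) => j'.
have HF : Sum (fun j : {j | f j == false} => u (val j)) = Sum (fun j => u (inr j)).
  pose h j : {j | f j == false} := exist (fun j => f j == false) (inr j) isT.
  have h' (jk : {j | f j == false}) : {j | jk = h j}.
    case: jk => [[j|k] p] //; exists k; exact: val_inj.
  rewrite -(@Sum_reindex _ _ h (fun jk => sval (h' jk))) //=.
  - by move=> j; case: (h' _) => j' /= [].
  - by move=> jk; case: (h' jk) => j'.
split.
  move/(Sum_partition f) => [y [Hy Hs]]; exists (y true), (y false).
  rewrite -HT -HF; split=> //; rewrite -Hs; apply: Sum_ext => -[] //.
move=> [a [b [Ha Hb Hab]]]; apply/(Sum_partition f).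
exists (fun b0 : bool => if b0 then a else b); split=> // -[]; first by rewrite HT.
by rewrite HF.
Qed.

Lemma pam_addC x y : pam_add x y = pam_add y x.
Proof.
rewrite /pam_add -(@Sum_reindex _ _ negb negb) //; try exact: negbK.
by apply: Sum_ext => -[].
Qed.

Lemma Sum_unit (x : M) : Sum (fun _ : unit => x) = Some x.
Proof. by rewrite (Sum_unary _ (j0 := tt)) //; case. Qed.

Lemma pam_add0 x : pam_add pam0 x = Some x.
Proof.
have : Sum (fun _ : (void + unit)%type => x) = Some x.
  by rewrite (Sum_unary _ (j0 := inr tt)) // => -[[]|[]].
case/Sum_sum => a [b []].
by rewrite Sum_void_like // Sum_unit => -[<-] [<-].
Qed.

Lemma pam_add_sum J K (u : J + K -> M) :
  Sum u = obind (fun a => obind (pam_add a) (Sum (fun k => u (inr k))))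
                (Sum (fun j => u (inl j))).
Proof.
apply: opt_ext => s; rewrite Sum_sum; split.
  by move=> [a [b [-> /= -> /= ->]]].
case: (Sum (fun j => u (inl j))) => //= a.
case: (Sum (fun k => u (inr k))) => //= b H; by exists a, b.
Qed.

Lemma pam_addA x y z :
  obind (fun s => pam_add s z) (pam_add x y) =
  obind (fun s => pam_add x s) (pam_add y z).
Proof.
pose T := (unit : countType).
pose u (i : (T + T) + T) : M :=
  match i with inl (inl _) => x | inl (inr _) => y | inr _ => z end.
pose v (i : T + (T + T)) : M :=
  match i with inl _ => x | inr (inl _) => y | inr (inr _) => z end.
pose h (i : T + (T + T)) : (T + T) + T :=
  match i with inl t => inl (inl t) | inr (inl t) => inl (inr t)
             | inr (inr t) => inr t end.
pose g (i : (T + T) + T) : T + (T + T) :=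
  match i with inl (inl t) => inl t | inl (inr t) => inr (inl t)
             | inr t => inr (inr t) end.
have : Sum v = Sum u.
  rewrite -(@Sum_reindex _ _ h g u); first by apply: Sum_ext => -[?|[?|?]].
  - by move=> [?|[?|?]].
  - by move=> [[?|?]|?].
by rewrite !pam_add_sum /= !Sum_unit /=.
Qed.

Definition pam_pcm : pcm := Pcm pam_addA pam_addC pam_add0.

End SigmaPAMTheory.

Arguments pam0 {M}.
Coercion pam_pcm : sigmaPAM >-> pcm.

Lemma sigma_additive_additive (M N : sigmaPAM) (f : M -> N) :
  sigma_additive f -> @additive M N f.
Proof.
move=> Hf; split.
  have := Hf _ _ _ (pam0E M); rewrite Sum_void_like; last by case.
  by case=> <-.
move=> x y s /Hf H; rewrite -H; apply: Sum_ext => -[] //.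
Qed.

Record category := Category {
  ob :> Type;
  mor : ob -> ob -> Type;
  idm : forall A, mor A A;
  mcomp : forall A B D, mor B D -> mor A B -> mor A D;
  compA : forall A B D E (h : mor D E) (g : mor B D) (f : mor A B),
    mcomp h (mcomp g f) = mcomp (mcomp h g) f;
  comp1m : forall A B (f : mor A B), mcomp (idm B) f = f;
  compm1 : forall A B (f : mor A B), mcomp f (idm A) = f }.

Arguments idm {c} A.
Notation "g \\o f" := (mcomp g f) (at level 50, left associativity).

Record countable_coproducts (C : category) := CountableCoproducts {
  coprod_of : forall J : countType, (J -> C) -> C;
  coproj_of : forall (J : countType) (B : J -> C) (j : J), mor (B j) (coprod_of B);
  cotuple_of : forall (J : countType) (B : J -> C) (D : C),
    (forall j, mor (B j) D) -> mor (coprod_of B) D;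
  cotuple_of_coproj : forall (J : countType) (B : J -> C) (D : C)
      (f : forall j, mor (B j) D) (j : J),
    cotuple_of f \\o coproj_of B j = f j;
  cotuple_of_unique : forall (J : countType) (B : J -> C) (D : C)
      (f : forall j, mor (B j) D) (h : mor (coprod_of B) D),
    (forall j, h \\o coproj_of B j = f j) -> h = cotuple_of f }.

Record preSigmaPAC := PreSigmaPAC {
  pac_cat :> category;
  pac_coprod : countable_coproducts pac_cat;
  pac_hom : forall A B : pac_cat, sigmaPAM_on (mor A B);
  pac_biadditive_l : forall (A B D : pac_cat) (f : mor A B),
    @sigma_additive (SigmaPAM (pac_hom B D)) (SigmaPAM (pac_hom A D))
      (fun g => g \\o f);
  pac_biadditive_r : forall (A B D : pac_cat) (g : mor B D),
    @sigma_additive (SigmaPAM (pac_hom A B)) (SigmaPAM (pac_hom A D))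
      (fun f => g \\o f) }.

Canonical homPAM (C : preSigmaPAC) (A B : C) : sigmaPAM := SigmaPAM (pac_hom A B).

Section PreSigmaPACTheory.
Variable C : preSigmaPAC.
Implicit Types A B D : C.

Definition zero_mor A B : mor A B := @pam0 (homPAM A B).

Definition mor_perp A B (f g : mor A B) : Prop := @perp (homPAM A B) f g.

Definition coprod (J : countType) (B : J -> C) : C := coprod_of (pac_coprod C) B.

Definition coproj (J : countType) (B : J -> C) (j : J) : mor (B j) (coprod B) :=
  coproj_of (pac_coprod C) B j.

Definition cotuple (J : countType) (B : J -> C) D (f : forall j, mor (B j) D) :
  mor (coprod B) D := cotuple_of (pac_coprod C) f.

(* The cotuple whose i-th component is the identity (transported along the
   equality k = i) and whose other components are zero. *)
Definition pproj (J : countType) (B : J -> C) (i : J) : mor (coprod B) (B i) :=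
  cotuple (fun k =>
    match k =P i with
    | ReflectT e => eq_rect k (fun l => mor (B k) (B l)) (idm (B k)) i e
    | ReflectF _ => zero_mor (B k) (B i)
    end).

Lemma pproj_coproj (J : countType) (B : J -> C) (i : J) :
  pproj B i \\o coproj B i = idm (B i).
Proof.
rewrite /pproj /cotuple /coproj cotuple_of_coproj.
by case: eqP => // e; rewrite (eq_axiomK e).
Qed.

Lemma pproj_coproj0 (J : countType) (B : J -> C) (i k : J) :
  k <> i -> pproj B i \\o coproj B k = zero_mor (B k) (B i).
Proof.
by move=> ne; rewrite /pproj /cotuple /coproj cotuple_of_coproj; case: eqP.
Qed.

Definition compatible (J : countType) A (B : J -> C) (f : forall j, mor A (B j)) :
  Prop := exists g : mor A (coprod B), forall j, pproj B j \\o g = f j.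

End PreSigmaPACTheory.

(* Binary coproducts are those indexed by [bool], with [true] as first index. *)
Record sigmaPAC := SigmaPAC {
  pac_pre :> preSigmaPAC;
  pac_compatible_sum : forall (J : countType) (A B : pac_pre) (f : J -> mor A B),
    @compatible pac_pre J A (fun=> B) f -> summable f;
  pac_untying : forall (A B : pac_pre) (f g : mor A B),
    mor_perp f g ->
    mor_perp (coproj (fun _ : bool => B) true \\o f)
                   (coproj (fun _ : bool => B) false \\o g) }.

Record sigmaEffectus := SigmaEffectus {
  eff_pac :> sigmaPAC;
  effI : eff_pac;
  truth : forall A : eff_pac, mor A effI;
  eff_ea : forall A : eff_pac, @effect_algebra_axiom (homPAM A effI) (truth A);
  eff_zero : forall (A B : eff_pac) (f : mor A B),
    truth B \\o f = zero_mor A effI -> f = zero_mor A B;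
  eff_perp : forall (A B : eff_pac) (f g : mor A B),
    mor_perp (truth B \\o f) (truth B \\o g) -> mor_perp f g }.

Arguments effI {s}.
Arguments truth {s} A.

Section Scalars.
Variable C : sigmaEffectus.

Definition predicates (A : C) : effectAlgebra := EffectAlgebra (@eff_ea C A).

Definition is_state (A : C) (w : mor effI A) : Prop := truth A \\o w = truth effI.

Definition admits_normalization : Prop :=
  forall (A : C) (w : mor effI A), w <> zero_mor effI A ->
    exists! v : mor effI A, is_state v /\ w = v \\o (truth A \\o w).

Lemma truth_I : truth effI = idm (effI : C).
Proof.
have [/(_ (idm effI)) [p [Hp _]] H2] := @eff_ea C effI.
have Ha := sigma_additive_additive (@pac_biadditive_r C effI effI effI (truth effI)).
have := Ha.2 _ _ _ Hp; rewrite /= compm1 => H.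
have Hp0 : p = zero_mor effI effI.
  apply: eff_zero; apply: H2; rewrite /perp pcm_addC /=.
  by rewrite [X in X <> _]H.
move: Hp; rewrite pcm_addC Hp0 [LHS](@pam_add0 (homPAM effI effI)).
by case.
Qed.

Lemma scalar_mul1 (a : predicates effI) : a \\o (ea1 : predicates effI) = a.
Proof. by rewrite /= truth_I compm1. Qed.

Lemma scalar_1mul (a : predicates effI) : (ea1 : predicates effI) \\o a = a.
Proof. by rewrite /= truth_I comp1m. Qed.

Definition scalars : effectMonoid :=
  @EffectMonoid (predicates effI) (fun a b => a \\o b)
    (fun a b c => compA a b c)
    (fun a => sigma_additive_additive (@pac_biadditive_l C _ _ _ a))
    (fun a => sigma_additive_additive (@pac_biadditive_r C _ _ _ a))
    scalar_mul1 scalar_1mul.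

End Scalars.

Section TrivialEffectMonoid.

Definition unit_add (x y : unit) : option unit := Some tt.

Definition unit_mul (x y : unit) : unit := tt.

Lemma unit_add0 x : unit_add tt x = Some x.
Proof. by case: x. Qed.

Definition unit_pcm : pcm :=
  @Pcm unit tt unit_add (fun _ _ _ => erefl) (fun _ _ => erefl) unit_add0.

Lemma unit_ea_axiom : @effect_algebra_axiom unit_pcm tt.
Proof. by split; case=> //; exists tt; split=> // -[]. Qed.

Definition unit_ea : effectAlgebra := EffectAlgebra unit_ea_axiom.

Lemma unit_additive (f : unit_ea -> unit_ea) : additive f.
Proof. by split=> [|x y s _] /=; [case: (f tt) | case: (f s)]. Qed.

Lemma unit_mul1 x : unit_mul x tt = x.
Proof. by case: x. Qed.

Definition unit_em : effectMonoid :=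
  @EffectMonoid unit_ea unit_mul (fun _ _ _ => erefl) (fun _ => unit_additive _)
    (fun _ => unit_additive _) unit_mul1 unit_mul1.

End TrivialEffectMonoid.

Section TwoElementEffectMonoid.

(* [false] is 0 and [true] is 1. *)
Definition bool_add (x y : bool) : option bool :=
  if x && y then None else Some (x || y).

Lemma bool_addA x y z :
  obind (fun s => bool_add s z) (bool_add x y) =
  obind (fun s => bool_add x s) (bool_add y z).
Proof. by case: x; case: y; case: z. Qed.

Lemma bool_addC x y : bool_add x y = bool_add y x.
Proof. by case: x; case: y. Qed.

Lemma bool_add0 x : bool_add false x = Some x.
Proof. by []. Qed.

Definition bool_pcm : pcm := Pcm bool_addA bool_addC bool_add0.

Lemma bool_ea_axiom : @effect_algebra_axiom bool_pcm true.
Proof.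
split=> [[]|[]] //; [exists false | exists true]; by split=> // -[].
Qed.

Definition bool_ea : effectAlgebra := EffectAlgebra bool_ea_axiom.

Lemma bool_additive_l (a : bool_ea) : @additive bool_ea bool_ea (fun b => b && a).
Proof. by split=> // -[] [] s //= [<-]; case: a. Qed.

Lemma bool_additive_r (a : bool_ea) : @additive bool_ea bool_ea (andb a).
Proof. by split=> [|[] [] s //= [<-]]; case: a. Qed.

Definition bool_em : effectMonoid :=
  @EffectMonoid bool_ea andb andbA bool_additive_l bool_additive_r andbT andTb.

End TwoElementEffectMonoid.

Section UnitInterval.
Local Open Scope ring_scope.
Variable R : realType.

Definition unit_interval : Type := {x : R | 0 <= x <= 1}.

Implicit Types x y z : unit_interval.

Lemma ui0_subproof : 0 <= (0 : R) <= 1. Proof. by rewrite lexx ler01. Qed.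
Lemma ui1_subproof : 0 <= (1 : R) <= 1. Proof. by rewrite lexx ler01. Qed.

Definition ui0 : unit_interval := exist _ 0 ui0_subproof.
Definition ui1 : unit_interval := exist _ 1 ui1_subproof.

Lemma ui_mul_subproof x y : 0 <= sval x * sval y <= 1.
Proof.
case: x y => [x /= /andP[x0 x1]] [y /= /andP[y0 y1]].
by rewrite mulr_ge0 // mulr_ile1.
Qed.

Definition ui_mul x y : unit_interval := exist _ (sval x * sval y) (ui_mul_subproof x y).

(* [insub r] is [None] unless 0 <= r <= 1. *)
Definition ui_add x y : option unit_interval := insub (sval x + sval y).

Lemma ui_inj x y : sval x = sval y -> x = y.
Proof. by move=> e; apply: val_inj. Qed.

Lemma ui_addP x y s : ui_add x y = Some s <-> sval x + sval y = sval s.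
Proof.
rewrite /ui_add; split; first by case: insubP => // u _ <- [<-].
move=> e; case: insubP => [u _ eu|]; last by rewrite e (valP s).
by congr Some; apply: ui_inj; rewrite -e -eu.
Qed.

Lemma ui_ge0 x : 0 <= sval x. Proof. by case/andP: (valP x). Qed.
Lemma ui_le1 x : sval x <= 1. Proof. by case/andP: (valP x). Qed.

Lemma ui_addC x y : ui_add x y = ui_add y x.
Proof. by rewrite /ui_add addrC. Qed.

Lemma ui_add0 x : ui_add ui0 x = Some x.
Proof. by apply/ui_addP; rewrite add0r. Qed.

Lemma ui_add_assoc x y z s :
  obind (fun t => ui_add t z) (ui_add x y) = Some s <->
  sval x + sval y + sval z = sval s.
Proof.
split.
  case E : (ui_add x y) => [t|] //= /ui_addP <-.
  by move/ui_addP: E => ->.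
move=> e; have Hxy : 0 <= sval x + sval y <= 1.
  rewrite addr_ge0 ?ui_ge0 //= (le_trans _ (ui_le1 s)) // -e.
  by rewrite lerDl ui_ge0.
have -> /= : ui_add x y = Some (exist _ (sval x + sval y) Hxy) by apply/ui_addP.
by apply/ui_addP.
Qed.

Lemma ui_addA x y z :
  obind (fun s => ui_add s z) (ui_add x y) =
  obind (fun s => ui_add x s) (ui_add y z).
Proof.
have -> : obind (fun s => ui_add x s) (ui_add y z) =
          obind (fun s => ui_add s x) (ui_add y z).
  by case: (ui_add y z) => //= t; rewrite ui_addC.
apply: opt_ext => s; rewrite !ui_add_assoc.
by rewrite [sval y + _ + _]addrC addrA.
Qed.

Definition ui_pcm : pcm := Pcm ui_addA ui_addC ui_add0.

Lemma ui_ea_axiom : @effect_algebra_axiom ui_pcm ui1.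
Proof.
split=> /= a.
  have Ha : 0 <= 1 - sval a <= 1.
    by rewrite subr_ge0 ui_le1 /= lerBlDr lerDl ui_ge0.
  exists (exist _ (1 - sval a) Ha); split.
    by apply/ui_addP; rewrite /= addrC subrK.
  by move=> b /ui_addP /= e; apply: ui_inj; apply/eqP; rewrite /= subr_eq addrC e.
rewrite /perp /=; case E : (ui_add a ui1) => [s|] // _.
move/ui_addP: E => /= E; apply: ui_inj; apply/eqP.
rewrite eq_le ui_ge0 andbT /=.
by have := ui_le1 s; rewrite -E gerDr.
Qed.

Definition ui_ea : effectAlgebra := EffectAlgebra ui_ea_axiom.

Lemma ui_additive_l (a : ui_ea) : @additive ui_ea ui_ea (fun b => ui_mul b a).
Proof.
split=> [|x y s /ui_addP e]; first by apply: ui_inj; rewrite /= mul0r.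
by apply/ui_addP; rewrite /= -mulrDl e.
Qed.

Lemma ui_additive_r (a : ui_ea) : @additive ui_ea ui_ea (ui_mul a).
Proof.
split=> [|x y s /ui_addP e]; first by apply: ui_inj; rewrite /= mulr0.
by apply/ui_addP; rewrite /= -mulrDr e.
Qed.

Lemma ui_mulA x y z : ui_mul x (ui_mul y z) = ui_mul (ui_mul x y) z.
Proof. by apply: ui_inj; rewrite /= mulrA. Qed.

Lemma ui_mul1 x : ui_mul x ui1 = x.
Proof. by apply: ui_inj; rewrite /= mulr1. Qed.

Lemma ui_1mul x : ui_mul ui1 x = x.
Proof. by apply: ui_inj; rewrite /= mul1r. Qed.

Definition unit_interval_em : effectMonoid :=
  @EffectMonoid ui_ea ui_mul ui_mulA ui_additive_l ui_additive_r ui_mul1 ui_1mul.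

End UnitInterval.

(* Main.v *)
From HB Require Import structures.
Require Import Defs.
From mathcomp Require Import all_boot all_order all_algebra reals.
From mathcomp Require Import boolp classical_sets.
From mathcomp Require Import ring lra.

(* Normalization of substates on I + I says exactly that scalars admit a unique
   right division: a <= s <> 0 has a unique c with a = c s.  In particular there
   are no zero divisors.
   If a is a scalar other than 0 and 1 with complement b, then ab = ba, and ab
   divided by ab + ab is a scalar equal to its own complement, so 1/2 exists.
   Complementary a and b are comparable: the probability h that a walk with up
   probability a and down probability b ever climbs one level satisfies
   h = a + b h h, which forces h = 1, hence b <= a, or a = b h <= b.  Dividing
   by a + b and halving extends this to all pairs, so the scalars are totally
   ordered.  They are Archimedean, as a countable multiple of a absorbs a.
   Comparison with dyadic multiples of 1/2^n then yields an additive,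
   multiplicative, injective map to [0,1], and completeness under countable sums
   makes it surjective.
   Conversely, over [0,1] the normalization of w with weight s is the N-fold sum
   of w scaled by 1/(N s), for any integer N >= 1/s. *)

Set Implicit Arguments.
Unset Strict Implicit.
Unset Printing Implicit Defensive.
Import Order.TTheory GRing.Theory Num.Theory.
Local Open Scope ring_scope.

(** * PCMs and effect algebras with an absorbing element *)

(* A PCM with an absorbing element [None] adjoined is a commutative monoid, in
   which "the sum is defined" reads "the sum is not [None]". *)
Definition ext (E : pcm) : Type := option E.
Definition fin (E : pcm) (x : E) : ext E := Some x.
Notation "x %:V" := (fin x) (at level 2, left associativity, format "x %:V").

HB.instance Definition _ (E : pcm) := gen_eqMixin (ext E).
HB.instance Definition _ (E : pcm) := gen_choiceMixin (ext E).

Section Ext.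
Variable E : pcm.
Implicit Types (x y z : ext E) (a b c : E).

Definition ext_add x y : ext E := obind (fun a => obind (@pcm_add E a) y) x.

Lemma ext_addC : commutative ext_add.
Proof. by move=> [a|] [b|] //=; rewrite pcm_addC. Qed.

Lemma ext_addA : associative ext_add.
Proof.
move=> [a|] [b|] [c|] //=; last by case: (pcm_add a b).
rewrite -[RHS]/(obind (fun u => obind (pcm_add u) (Some c)) (pcm_add a b)) /=.
exact/esym/pcm_addA.
Qed.

Lemma ext_add0 : left_id (@pcm0 E)%:V ext_add.
Proof. by case=> //= a; rewrite pcm_add0. Qed.

HB.instance Definition _ :=
  GRing.isNmodule.Build (ext E) ext_addA ext_addC ext_add0.

Lemma fin_add a b : a%:V + b%:V = pcm_add a b. Proof. by []. Qed.

Lemma fin_inj : injective (@fin E). Proof. by move=> a b []. Qed.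

Lemma fin0 : (@pcm0 E)%:V = 0. Proof. by []. Qed.

Lemma addN x : (None : ext E) + x = None. Proof. by []. Qed.

Lemma fin_neqN a : a%:V <> None. Proof. by []. Qed.

Lemma extP x : x <> None -> exists a, x = a%:V.
Proof. by case: x => // a; exists a. Qed.

Lemma fin_addl x y : x + y <> None -> x <> None.
Proof. by case: x. Qed.

Lemma fin_addr x y : x + y <> None -> y <> None.
Proof. by rewrite addrC; exact: fin_addl. Qed.

Lemma add_eq_fin x y c : x + y = c%:V -> exists a b, x = a%:V /\ y = b%:V.
Proof. by case: x => [a|] //; case: y => [b|] // _; exists a, b. Qed.

(** The witness may be [None], so [None] is the top element. *)
Definition ext_le x y : Prop := exists z, x + z = y.
Local Notation "x <=: y" := (ext_le x y) (at level 70).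

Lemma ext_le_refl x : x <=: x. Proof. by exists 0; rewrite addr0. Qed.

Lemma ext_le_trans x y z : x <=: y -> y <=: z -> x <=: z.
Proof. by move=> [u <-] [v <-]; exists (u + v); rewrite addrA. Qed.

Lemma ext_leN x : x <=: None.
Proof. by exists None; rewrite addrC addN. Qed.

Lemma ext_le0 x : 0 <=: x. Proof. by exists x; rewrite add0r. Qed.

Lemma ext_le_fin x y : x <=: y -> y <> None -> x <> None.
Proof. by move=> [z <-]; exact: fin_addl. Qed.

Lemma ext_le_addr x y : x <=: x + y. Proof. by exists y. Qed.

Lemma ext_le_add x y x' y' : x <=: x' -> y <=: y' -> x + y <=: x' + y'.
Proof. by move=> [u <-] [v <-]; exists (u + v); rewrite addrACA. Qed.

Lemma ext_le_muln x y n : x <=: y -> x *+ n <=: y *+ n.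
Proof. by move=> [u <-]; exists (u *+ n); rewrite mulrnDl. Qed.

Lemma ext_le_mulnr x m n : (m <= n)%N -> x *+ m <=: x *+ n.
Proof. by move=> /subnKC <-; rewrite mulrnDr; exact: ext_le_addr. Qed.

Lemma ext_le_finP a b : a%:V <=: b%:V -> exists c, a%:V + c%:V = b%:V.
Proof. by move=> [[c|]] // e; exists c. Qed.

End Ext.
Notation "x <=: y" := (ext_le x y) (at level 70).

(** * Cancellation and order in effect algebras *)

Section EffectAlgebra.
Variable E : effectAlgebra.
Implicit Types (x y z : ext E) (a b c : E).
Local Notation one := (@ea1 E).

Lemma compl_exists a : exists b, a%:V + b%:V = one%:V.
Proof. by have [/(_ a) [b [e _]] _] := ea_axiom E; exists b. Qed.

Lemma compl_unique a b c :
  a%:V + b%:V = one%:V -> a%:V + c%:V = one%:V -> b = c.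
Proof.
by have [/(_ a) [d [_ u]] _] := ea_axiom E => /u <- /u <-.
Qed.

Lemma perp_one a : a%:V + one%:V <> None -> a = pcm0.
Proof. by have [_ H] := ea_axiom E => /H. Qed.

(** Adding the complement [t] of the common sum turns [y] and [z] into two complements of [x + t],
    and complements are unique. *)
Lemma ext_addI x y z : x + y = x + z -> x + y <> None -> y = z.
Proof.
move=> e f.
have [s Es] := extP f; have [t Et] := compl_exists s.
have [b Eb] := extP (fin_addr f).
have fz : x + z <> None by rewrite -e.
have [c Ec] := extP (fin_addr fz).
have [a Ea] := extP (fin_addl f).
rewrite Eb Ec; congr fin.
have H1 : (x + t%:V) + b%:V = one%:V by rewrite addrAC -Eb Es.
have H2 : (x + t%:V) + c%:V = one%:V by rewrite addrAC -Ec -e Es.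
have [u [v [Eu _]]] := add_eq_fin H1.
by rewrite Eu in H1 H2; exact: compl_unique H1 H2.
Qed.

(** Since [0 + one] is defined, so is [x + one], and only zero is summable with [one]. *)
Lemma ext_add_eq0 x y : x + y = 0 -> x = 0.
Proof.
move=> e; have [a [b [Ea Eb]]] : exists a b, x = a%:V /\ y = b%:V.
  by apply: (@add_eq_fin _ _ _ pcm0); rewrite e.
rewrite Ea; congr fin; apply: perp_one => E1.
have : x + y + one%:V = one%:V by rewrite e add0r.
by rewrite addrAC Ea E1.
Qed.

Lemma ext_le_anti x y : x <=: y -> y <=: x -> x = y.
Proof.
move=> [z Ez] [w Ew].
case: x Ez Ew => [a|] Ez Ew; last by rewrite -Ez.
have : a%:V + (z + w) = a%:V + 0 by rewrite addrA Ez Ew addr0.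
move=> /ext_addI H; rewrite addrA Ez Ew in H.
by rewrite -Ez (ext_add_eq0 (H _)) ?addr0.
Qed.

Lemma ext_le1 a : a%:V <=: one%:V.
Proof. by have [b <-] := compl_exists a; exact: ext_le_addr. Qed.

Lemma ext_le_addI x y z : x + y <=: x + z -> x + z <> None -> y <=: z.
Proof.
move=> [w]; rewrite -addrA => e f; by exists w; apply: (ext_addI e); rewrite e.
Qed.

Lemma add_eq_self x y : x + y = x -> x <> None -> y = 0.
Proof.
by move=> e f; apply: (@ext_addI x); rewrite ?e ?addr0.
Qed.

Lemma ext_le_zero x : x <=: 0 -> x = 0.
Proof. by move=> [y /ext_add_eq0]. Qed.

End EffectAlgebra.

Section Additive.
Variables (E F : pcm) (f : E -> F).
Hypothesis f_add : Defs.additive f.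

Lemma additive_fin a b c : a%:V + b%:V = c%:V -> (f a)%:V + (f b)%:V = (f c)%:V.
Proof. exact: f_add.2. Qed.

Lemma additive_muln a b n : a%:V *+ n = b%:V -> (f a)%:V *+ n = (f b)%:V.
Proof.
elim: n b => [|n IH] b; first by rewrite !mulr0n => -[<-]; rewrite f_add.1.
rewrite !mulrS => e; have [a' [c [[ea] ec]]] := add_eq_fin e.
by rewrite (IH c) //; apply: additive_fin; rewrite -ec.
Qed.

Lemma additive_le a b : a%:V <=: b%:V -> (f a)%:V <=: (f b)%:V.
Proof.
move=> /ext_le_finP [c /additive_fin <-]; exact: ext_le_addr.
Qed.

Lemma additive_muln_le a b n : a%:V *+ n <=: b%:V -> (f a)%:V *+ n <=: (f b)%:V.
Proof.
move=> H; have [c Ec] := extP (ext_le_fin H (@fin_neqN _ _)).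
by rewrite (additive_muln Ec); apply: additive_le; rewrite -Ec.
Qed.

End Additive.

(** * Countable sums *)

(** Lets [%:V] and the order apply directly to elements of a sigma-PAM. *)
Canonical pam_pcm.

Section SigmaSums.
Variable P : sigmaPAM.

Definition ext_sum (J : countType) (x : J -> P) : ext P := Sum x.

Lemma ext_sum_split (J K L : countType) (h : J + K -> L) (x : L -> P) :
  bijective h ->
  ext_sum x = ext_sum (fun j => x (h (inl j))) + ext_sum (fun k => x (h (inr k))).
Proof.
case=> g hK gK; rewrite /ext_sum -(Sum_reindex x hK gK) pam_add_sum.
by case: (Sum _) => [a|] //; case: (Sum _).
Qed.

Lemma ext_sum_ord (d : nat -> P) n :
  ext_sum (fun i : 'I_n => d i) = \sum_(i < n) (d i)%:V.
Proof.
elim: n => [|n IH].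
  by rewrite big_ord0 /ext_sum Sum_void_like //; case.
pose h (i : 'I_n + unit) : 'I_n.+1 :=
  if i is inl j then lift ord_max j else ord_max.
have hb : bijective h.
  exists (fun i => if unlift ord_max i is Some j then inl j else inr tt).
    by case=> [j|[]]; rewrite /h ?liftK ?unlift_none.
  by move=> i; case: unliftP => [j ->|->].
rewrite big_ord_recr /= -IH (ext_sum_split _ hb).
congr (_ + _); last exact: (Sum_unit (d n)).
by apply: Sum_ext => i; rewrite -[in RHS](lift_max i).
Qed.

Lemma ext_sum_recl (d : nat -> P) :
  ext_sum d = (d 0%N)%:V + ext_sum (fun n => d n.+1).
Proof.
pose h (i : unit + nat) : nat := if i is inr n then n.+1 else 0%N.
have hb : bijective h.
  exists (fun n => if n is m.+1 then inr m else inl tt); last by case.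
  by case=> [[]|n].
by rewrite (ext_sum_split _ hb); congr (_ + _); exact: (Sum_unit (d 0%N)).
Qed.

(** [p] splits [J] into two blocks, and partition-associativity makes the block over [true]
    summable. *)
Lemma ext_sum_sub (J : countType) (p : pred J) (x : J -> P) :
  Sum x <> None -> Sum (fun j : {j | p j} => x (val j)) <> None.
Proof.
move=> H; have [s Es] := @extP P _ H.
have [y [Hy _]] := (Sum_partition p x s).1 Es.
have e : forall j, (p j == true) = p j by move=> j; case: (p j).
pose f (j : {j | p j}) : {j | p j == true} :=
  exist _ (val j) (etrans (e _) (valP j)).
pose g (j : {j | p j == true}) : {j | p j} :=
  exist _ (val j) (etrans (esym (e _)) (valP j)).
rewrite -(@Sum_reindex P _ _ g f); last 2 first.
- by move=> j; apply: val_inj.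
- by move=> j; apply: val_inj.
by have := Hy true; rewrite /= => ->.
Qed.

(** Every finite subfamily lies in an initial segment, whose subfamilies are summable; the limit
    axiom concludes. *)
Lemma ext_sum_nat_fin (d : nat -> P) :
  (forall n, \sum_(i < n) (d i)%:V <> None :> ext P) -> ext_sum d <> None.
Proof.
move=> H; apply: pam_limit => F.
pose n := (\max_(i <- F) i).+1.
have ltn j : j \in F -> (j < n)%N by move=> jF; rewrite ltnS; exact: leq_bigmax_seq.
have := H n; rewrite -ext_sum_ord => /(@ext_sum_sub _ (fun i : 'I_n => val i \in F)).
pose f (j : {j | j \in F}) : {i : 'I_n | val i \in F} :=
  exist (fun i : 'I_n => val i \in F) (Ordinal (ltn _ (valP j))) (valP j).
pose g (i : {i : 'I_n | val i \in F}) : {j | j \in F} :=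
  exist _ (val (val i)) (valP i).
by rewrite -(@Sum_reindex P _ _ f g) // => j; do 2?apply: val_inj.
Qed.

Lemma ext_psum_le (d : nat -> P) n : \sum_(i < n) (d i)%:V <=: ext_sum d.
Proof.
elim: n d => [|n IH] d; first by rewrite big_ord0; exact: ext_le0.
rewrite big_ord_recl ext_sum_recl; apply: ext_le_add; first exact: ext_le_refl.
exact: IH.
Qed.

End SigmaSums.

(** * Bounds on countable sums, the Archimedean property, suprema of chains *)

Section SigmaEffectAlgebra.
Variables (M : sigmaPAM) (one : M).
Hypothesis ax : @effect_algebra_axiom M one.
Let E := EffectAlgebra ax.

(** Prepending the complement [v] of [u] to [d] keeps all partial sums below [one], so [v] plus the
    whole sum is defined and at most [one = v + u]; cancel [v]. *)
Lemma ext_sum_le (d : nat -> M) (u : M) :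
  (forall n, \sum_(i < n) (d i)%:V <=: u%:V) -> ext_sum d <=: u%:V.
Proof.
move=> H; have [v Ev] := @compl_exists E u.
pose d' n := if n is m.+1 then d m else v.
have H' n : \sum_(i < n) (d' i)%:V <=: one%:V.
  case: n => [|n]; first by rewrite big_ord0; exact: ext_le0.
  rewrite big_ord_recl /= -[X in _ <=: X]Ev addrC.
  by apply: ext_le_add; [exact: H | exact: ext_le_refl].
have [|s Es] := @extP M (ext_sum d').
  by apply: ext_sum_nat_fin => n; apply: ext_le_fin (H' n) _.
have : v%:V + ext_sum d <=: v%:V + u%:V.
  have -> : v%:V + ext_sum d = ext_sum d' by rewrite [RHS]ext_sum_recl.
  by rewrite Es [X in _ <=: X]addrC Ev; exact: (@ext_le1 E).
move/(@ext_le_addI E); apply.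
by rewrite addrC Ev.
Qed.

(** The sum of countably many copies of [a] is defined and absorbs one more copy, so cancellation
    gives zero. *)
Lemma archimedean (a : M) : (forall n, a%:V *+ n <> None) -> a = pam0.
Proof.
move=> H; have H' : ext_sum (fun _ : nat => a) <> None.
  by apply: ext_sum_nat_fin => n; rewrite sumr_const card_ord; exact: H.
have : ext_sum (fun _ : nat => a) + a%:V = ext_sum (fun _ : nat => a).
  by rewrite [in RHS]ext_sum_recl addrC.
by move=> /(@add_eq_self E) /(_ H') [].
Qed.

Definition is_sup (x : nat -> M) (s : M) : Prop :=
  (forall n, (x n)%:V <=: s%:V) /\
  (forall u : M, (forall n, (x n)%:V <=: u%:V) -> s%:V <=: u%:V).

(** The supremum is the countable sum of the increments; sigma-additive maps preserve that sum, so
    one [s] serves all [f]. *)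
Lemma chain_sup (x : nat -> M) :
  (forall n, (x n)%:V <=: (x n.+1)%:V) ->
  exists s, forall f : M -> M, sigma_additive f -> is_sup (f \o x) (f s).
Proof.
move=> Hx; have [c Hc] := choice (fun n => ext_le_finP (Hx n)).
pose d n := if n is m.+1 then c m else x 0%N.
have Hd n : \sum_(i < n.+1) (d i)%:V = (x n)%:V.
  elim: n => [|n IH]; first by rewrite big_ord1.
  by rewrite big_ord_recr /= IH Hc.
have [|s Es] := @extP M (ext_sum d).
  by apply: ext_sum_nat_fin => -[|n]; rewrite ?big_ord0 // Hd.
exists s => f Hf.
have f_add := sigma_additive_additive Hf.
have Efs : ext_sum (fun n => f (d n)) = (f s)%:V by apply: Hf.
have Hfd n : \sum_(i < n.+1) (f (d i))%:V = (f (x n))%:V.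
  elim: n => [|n IH]; first by rewrite big_ord1.
  by rewrite big_ord_recr /= IH; exact: (additive_fin f_add (Hc n)).
split=> [n|u Hu] /=; first by rewrite -Hfd -Efs; exact: ext_psum_le.
rewrite -Efs; apply: ext_sum_le => -[|n]; first by rewrite big_ord0; exact: ext_le0.
by rewrite Hfd; exact: Hu.
Qed.

End SigmaEffectAlgebra.

(** * Effect monoids with right division *)

(** Keeps the countable sums of the scalars, on which suprema and the Archimedean property rest. *)
Record sigmaEffectMonoid := SigmaEffectMonoid {
  sem_pam :> sigmaPAM;
  sem1 : sem_pam;
  sem_axiom : @effect_algebra_axiom sem_pam sem1;
  sem_mul : sem_pam -> sem_pam -> sem_pam;
  sem_mulA : forall a b c, sem_mul a (sem_mul b c) = sem_mul (sem_mul a b) c;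
  sem_sigma_l : forall a, sigma_additive (fun b => sem_mul b a);
  sem_sigma_r : forall a, sigma_additive (sem_mul a);
  sem_mul1 : forall a, sem_mul a sem1 = a;
  sem_1mul : forall a, sem_mul sem1 a = a }.

Definition sem_ea (M : sigmaEffectMonoid) : effectAlgebra :=
  EffectAlgebra (@sem_axiom M).

Definition sem_em (M : sigmaEffectMonoid) : effectMonoid :=
  @EffectMonoid (sem_ea M) (@sem_mul M) (@sem_mulA M)
    (fun a => sigma_additive_additive (@sem_sigma_l M a))
    (fun a => sigma_additive_additive (@sem_sigma_r M a))
    (@sem_mul1 M) (@sem_1mul M).

Definition right_division (M : effectMonoid) : Prop :=
  forall a s : M, a%:V <=: s%:V -> s <> pcm0 -> exists! c, em_mul c s = a.

Section Division.
Variable S : sigmaEffectMonoid.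
Local Notation M := (sem_em S).
Hypothesis div : right_division M.
Implicit Types (a b c s x y z : M).
Local Notation one := (ea1 : M).
Local Notation "a ** b" := (@em_mul M a b) (at level 40, left associativity).

Lemma sem_mulDl a b c s : a%:V + b%:V = s%:V -> (a ** c)%:V + (b ** c)%:V = (s ** c)%:V.
Proof. exact: (additive_fin (em_additive_l c)). Qed.

Lemma sem_mulDr a b c s : a%:V + b%:V = s%:V -> (c ** a)%:V + (c ** b)%:V = (c ** s)%:V.
Proof. exact: (additive_fin (em_additive_r c)). Qed.

Lemma sem_mul0l a : pcm0 ** a = pcm0. Proof. exact: (em_additive_l a).1. Qed.

Lemma sem_mul0r a : a ** pcm0 = pcm0. Proof. exact: (em_additive_r a).1. Qed.

Lemma sem_mul_lel a b c : a%:V <=: b%:V -> (a ** c)%:V <=: (b ** c)%:V.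
Proof. exact: (additive_le (em_additive_l c)). Qed.

Lemma sem_mul_ler a b c : a%:V <=: b%:V -> (c ** a)%:V <=: (c ** b)%:V.
Proof. exact: (additive_le (em_additive_r c)). Qed.

Lemma sem_mul_le1l a b : (a ** b)%:V <=: b%:V.
Proof. by rewrite -[b in X in _ <=: X]em_1mul; apply: sem_mul_lel; exact: ext_le1. Qed.

Lemma sem_mul_le1r a b : (a ** b)%:V <=: a%:V.
Proof. by rewrite -[a in X in _ <=: X]em_mul1; apply: sem_mul_ler; exact: ext_le1. Qed.

(** Both factors are quotients of [b ** s] by [s]. *)
Lemma sem_mulIr a b s : s <> pcm0 -> a ** s = b ** s -> a = b.
Proof.
by move=> s0 e; have [c [_ u]] := div (sem_mul_le1l b s) s0; rewrite -(u a e) (u b).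
Qed.

(** Expanding [a = a ** one = one ** a] gives [aa + ab = aa + ba]. *)
Lemma compl_comm a b : a%:V + b%:V = one%:V -> a ** b = b ** a.
Proof.
move=> e; apply: fin_inj; apply: (@ext_addI M (a ** a)%:V).
  by rewrite (sem_mulDr a e) (sem_mulDl a e) em_1mul em_mul1.
by rewrite (sem_mulDr a e).
Qed.

Lemma fin_eq0 a : a%:V = 0 :> ext M -> a = pcm0. Proof. by case. Qed.

(* The monotone iteration computes the probability [h] that a random walk
   stepping up with probability [a] and down with probability [b] ever reaches
   the level above its start; [h] solves [h = a + b h h], that is
   [(1 - h) a = (1 - h) b h]. *)
Lemma compl_comparable a b :
  a%:V + b%:V = one%:V -> a%:V <=: b%:V \/ b%:V <=: a%:V.
Proof.
move=> ab1.
have step y : exists z, z%:V = a%:V + (b ** y)%:V.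
  have [|z Ez] := @extP M (a%:V + (b ** y)%:V); last by exists z.
  apply: (@ext_le_fin _ _ one%:V) => //; rewrite -ab1.
  by apply: ext_le_add; [exact: ext_le_refl | exact: sem_mul_le1r].
have [phi Hphi] := choice step.
pose h n := iter n (fun y => phi (y ** y)) pcm0.
have hS n : (h n.+1)%:V = a%:V + (b ** (h n ** h n))%:V by rewrite /h iterS Hphi.
have h_le n : (h n)%:V <=: (h n.+1)%:V.
  elim: n => [|n IH]; first exact: ext_le0.
  rewrite !hS; apply: ext_le_add; first exact: ext_le_refl.
  apply: sem_mul_ler; apply: ext_le_trans (sem_mul_lel _ IH) (sem_mul_ler _ IH).
have h_mono m n : (m <= n)%N -> (h m)%:V <=: (h n)%:V.
  move=> /subnKC <-; elim: (n - m)%N => [|k IH]; rewrite ?addn0 ?addnS.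
    exact: ext_le_refl.
  exact: ext_le_trans IH (h_le _).
have [H Hsup] := @chain_sup S (sem1 S) (@sem_axiom S) h h_le.
have id_sigma : sigma_additive (id : S -> S) by [].
have supH1 n : (h n)%:V <=: H%:V by exact: (Hsup _ id_sigma).1.
have supH2 := (Hsup _ id_sigma).2.
(* A bound on the diagonal bounds all [b h_m h_n] through the maximum index; suprema are then taken
   in one factor at a time. *)
have sq : is_sup (fun n => b ** (h n ** h n)) (b ** (H ** H)).
  split=> [n|u Hu].
    apply: sem_mul_ler.
    exact: ext_le_trans (sem_mul_lel _ (supH1 _)) (sem_mul_ler _ (supH1 _)).
  have Hmn m n : (b ** (h m ** h n))%:V <=: u%:V.
    apply: ext_le_trans (Hu (maxn m n)).
    apply: sem_mul_ler; apply: (@ext_le_trans _ _ (h (maxn m n) ** h n)%:V).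
      by apply: sem_mul_lel; apply: h_mono; exact: leq_maxl.
    by apply: sem_mul_ler; apply: h_mono; exact: leq_maxr.
  have Hm m : (b ** (h m ** H))%:V <=: u%:V.
    rewrite em_mulA; apply: (Hsup _ (@sem_sigma_r S (b ** h m))).2 => n /=.
    by have := Hmn m n; rewrite em_mulA.
  have sigma_bH : sigma_additive (fun z : S => b ** (z ** H)).
    move=> J x t /(@sem_sigma_l S H) /(@sem_sigma_r S b); exact.
  by apply: (Hsup _ sigma_bH).2.
have HE : H%:V = a%:V + (b ** (H ** H))%:V.
  have [z Ez] := step (H ** H); rewrite -Ez; apply: (@ext_le_anti M).
    apply: supH2 => -[|n]; first exact: ext_le0.
    rewrite Ez hS; apply: ext_le_add; [exact: ext_le_refl | exact: sq.1].
  (* For the other inequality, what remains of [H] after removing [a] bounds every [b h_n h_n]. *)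
  have [w Ew] : a%:V <=: H%:V.
    apply: ext_le_trans (supH1 1%N); rewrite hS; exact: ext_le_addr.
  have [_ [w' [_ Ew']]] := add_eq_fin Ew.
  rewrite Ez -Ew Ew'; apply: ext_le_add; first exact: ext_le_refl.
  apply: sq.2 => n; rewrite -Ew'.
  by apply: (@ext_le_addI M a%:V); rewrite Ew // -hS; exact: supH1.
have [g Eg] := @compl_exists M H.
have [g0|gn0] := EM (g = pcm0).
- right.
  have H1 : H = one by apply: fin_inj; rewrite -Eg g0 addr0.
  (* It suffices that [b h_n <= a]. Inductively [b b h_n h_n <= b a h_n = a b h_n <= a a], and
     [b a + a a = a]. *)
  rewrite -[b]em_mul1 -H1; apply: (Hsup _ (@sem_sigma_r S b)).2 => n /=.
  elim: n => [|n IH]; first by rewrite [sem_mul _ _]sem_mul0r; exact: ext_le0.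
  rewrite -(sem_mulDr b (esym (hS n))).
  have -> : a%:V = (b ** a)%:V + (a ** a)%:V :> ext M.
    by rewrite (sem_mulDl a (_ : b%:V + a%:V = one%:V)) ?em_1mul // addrC.
  apply: ext_le_add; first exact: ext_le_refl.
  apply: (@ext_le_trans _ _ (a ** (b ** h n))%:V); last exact: sem_mul_ler.
  rewrite (em_mulA a b) (compl_comm ab1) -em_mulA; apply: sem_mul_ler.
  by rewrite em_mulA; apply: sem_mul_lel.
- left; suff -> : a = b ** H by exact: sem_mul_le1r.
  apply: (sem_mulIr gn0).
  (* Cancelling [H] in [H + g = a + b] leaves [g = bHg + bg]; against [g = ag + bg] this gives
     [ag = bHg], and [g] cancels. *)
  have E1 : g%:V = (a ** g)%:V + (b ** g)%:V.
    by rewrite (sem_mulDl g ab1) em_1mul.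
  have E2 : b%:V = (b ** (H ** H))%:V + (b ** H ** g)%:V + (b ** g)%:V.
    rewrite em_mulA (sem_mulDr (b ** H) Eg) em_mul1.
    by rewrite (sem_mulDr b Eg) em_mul1.
  have E3 : H%:V + g%:V = H%:V + ((b ** H ** g)%:V + (b ** g)%:V).
    by rewrite Eg -ab1 {1}HE -!addrA; congr (_ + _); rewrite addrA.
  have := @ext_addI M _ _ _ E3; rewrite Eg => /(_ (@fin_neqN _ _)).
  rewrite {1}E1 ![_ + (b ** g)%:V]addrC => /(@ext_addI M) H4.
  by apply: fin_inj; apply: H4; rewrite addrC -E1.
Qed.

(** Division by the sum [s] turns [a] and [b] into complementary scalars, and multiplying back by
    [s] preserves the order. *)
Lemma perp_comparable a b :
  a%:V + b%:V <> None :> ext M -> a%:V <=: b%:V \/ b%:V <=: a%:V.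
Proof.
move=> /extP [s Es].
have [s0|sn0] := EM (s = pcm0).
  left; rewrite (@ext_add_eq0 M a%:V b%:V) ?Es ?s0 //; exact: ext_le0.
have [|c [Ec _]] := div (_ : a%:V <=: s%:V) sn0; first by rewrite -Es; exact: ext_le_addr.
have [d Ed] := compl_exists c.
have Edb : d ** s = b.
  apply: fin_inj; apply: (@ext_addI M a%:V); last by rewrite -Ec (sem_mulDl s Ed).
  by rewrite -Ec (sem_mulDl s Ed) em_1mul Ec Es.
rewrite -Ec -Edb.
by have [] := compl_comparable Ed; [left|right]; exact: sem_mul_lel.
Qed.

Lemma half_exists :
  [\/ one = pcm0, forall a, a = pcm0 \/ a = one | exists q, q%:V *+ 2 = one%:V].
Proof.
have [|none0] := EM (one = pcm0); first by constructor 1.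
have [|] := EM (forall a, a = pcm0 \/ a = one); first by constructor 2.
move=> /existsNP [a /not_orP [a0 a1]]; constructor 3.
have [b ab1] := compl_exists a.
have b0 : b <> pcm0 by move=> b0; apply: a1; apply: fin_inj; rewrite -ab1 b0 addr0.
pose p := a ** b.
have pn0 : p <> pcm0.
  by move=> p0; apply: a0; apply: (sem_mulIr b0); rewrite -/p p0 sem_mul0l.
have [|s Es] := @extP M (p%:V *+ 2).
  (* [p + p] is defined because [ab] lies below both [a] and [b]. *)
  apply: (@ext_le_fin _ _ (a%:V + b%:V)); last by rewrite ab1.
  by rewrite mulr2n; apply: ext_le_add; [exact: sem_mul_le1r | exact: sem_mul_le1l].
have sn0 : s <> pcm0.
  move=> s0; apply: pn0; apply: fin_eq0; apply: (@ext_add_eq0 M _ p%:V).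
  by rewrite -mulr2n Es s0.
have [|q [Eq _]] := div (_ : p%:V <=: s%:V) sn0.
  by rewrite -Es mulr2n; exact: ext_le_addr.
have [r Er] := compl_exists q.
(* The complement [r] of [q] is also a quotient of [p] by [s], so [r = q] and [q + q = one]. *)
have rs : r ** s = p.
  have Ers : p%:V + (r ** s)%:V = s%:V by rewrite -[in LHS]Eq (sem_mulDl s Er) em_1mul.
  apply: fin_inj; apply: (@ext_addI M p%:V); first by rewrite Ers -Es mulr2n.
  by rewrite Ers.
by exists q; rewrite mulr2n -[in RHS]Er (sem_mulIr sn0 (etrans Eq (esym rs))).
Qed.

End Division.

(** * Representation in the unit interval *)

Lemma le_dyadic_eps (R : realType) (c x y : R) :
  (forall n, x <= y + c / 2 ^+ n) -> x <= y.
Proof.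
move=> H; rewrite leNgt; apply/negP => yx.
have d0 : 0 < x - y by rewrite subr_gt0.
(* For nonnegative [c], [c / (x - y) < n + 1 <= 2 ^ n]. *)
pose n := Num.truncn (c / (x - y)).
have cn : c < (x - y) * 2 ^+ n.
  rewrite -ltr_pdivrMl // mulrC.
  have [c0|c0] := leP 0 (c / (x - y)); last exact: lt_trans c0 (exprn_gt0 _ _).
  have /andP[_ lt] := truncn_itv c0; apply: lt_le_trans lt _.
  by rewrite -natrX ler_nat -/n; exact: ltn_expl.
have := H n; apply/negP; rewrite -ltNge -ltrBrDl ltr_pdivrMr ?exprn_gt0 //.
Qed.

Section Representation.
Variables (R : realType) (S : sigmaEffectMonoid).
Local Notation M := (sem_em S).
Hypothesis div : right_division M.
Implicit Types (a b c s : M) (x y z : ext M).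
Local Notation one := (ea1 : M).
Local Notation "a ** b" := (@em_mul M a b) (at level 40, left associativity).
Hypothesis one_neq0 : one <> pcm0.
Variable q : M.
Hypothesis q2 : q%:V *+ 2 = one%:V.

Lemma half_mul2 a : (q ** a)%:V *+ 2 = a%:V.
Proof. by rewrite (additive_muln (em_additive_l a) q2) em_1mul. Qed.

(** Halves of any two scalars are summable, hence comparable; doubling carries the comparison
    back. *)
Lemma sem_total a b : a%:V <=: b%:V \/ b%:V <=: a%:V.
Proof.
have [|H|H] := perp_comparable div (_ : (q ** a)%:V + (q ** b)%:V <> None).
- apply: (@ext_le_fin _ _ one%:V) => //; rewrite -q2 mulr2n.
  by apply: ext_le_add; exact: sem_mul_le1r.
- by left; rewrite -(half_mul2 a) -(half_mul2 b); exact: ext_le_muln.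
- by right; rewrite -(half_mul2 a) -(half_mul2 b); exact: ext_le_muln.
Qed.

Lemma ext_total x y : x <=: y \/ y <=: x.
Proof.
case: x y => [a|] [b|]; first exact: sem_total.
- by left; exact: ext_leN.
- by right; exact: ext_leN.
- by left; exact: ext_leN.
Qed.

(** * Dyadic scalars and the real number represented by a scalar *)

Definition dyad n : M := iter n (em_mul q) one.

Lemma dyad_shift m n : (dyad (m + n))%:V *+ (2 ^ n) = (dyad m)%:V.
Proof.
elim: n => [|n IH]; first by rewrite addn0 mulr1n.
by rewrite addnS expnS mulrnA half_mul2.
Qed.

Lemma dyad_muln n : (dyad n)%:V *+ (2 ^ n) = one%:V.
Proof. exact: (dyad_shift 0). Qed.

Lemma dyad_mul_muln n a : (dyad n ** a)%:V *+ (2 ^ n) = a%:V.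
Proof. by rewrite (additive_muln (em_additive_l a) (dyad_muln n)) em_1mul. Qed.

Lemma dyad_fin n k : (k <= 2 ^ n)%N -> (dyad n)%:V *+ k <> None.
Proof.
move=> kn; apply: (ext_le_fin (ext_le_mulnr _ kn)).
by rewrite dyad_muln.
Qed.

Lemma dyad_neq0 n : (dyad n)%:V <> 0.
Proof.
move=> e; apply: one_neq0; apply: fin_eq0.
by rewrite -(dyad_muln n) e mul0rn.
Qed.

(** If [l < k], antisymmetry equates the two multiples, and cancellation makes [dyad n] zero. *)
Lemma dyad_le_inj n k l :
  (dyad n)%:V *+ k <=: (dyad n)%:V *+ l -> (dyad n)%:V *+ k <> None -> (k <= l)%N.
Proof.
move=> H f; rewrite leqNgt; apply/negP => lk.
have e : (dyad n)%:V *+ k = (dyad n)%:V *+ l.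
  by apply: (@ext_le_anti M) => //; exact/ext_le_mulnr/ltnW.
have := e; rewrite -[in LHS](subnKC lk) addSnnS mulrnDr => /(@add_eq_self M).
rewrite -e => /(_ f); rewrite mulrS => /(@ext_add_eq0 M).
exact: dyad_neq0.
Qed.

Definition rep_set a : set R :=
  [set t | exists n k, t = k%:R / 2 ^+ n /\ (dyad n)%:V *+ k <=: a%:V]%classic.

Definition rep a : R := sup (rep_set a).

Lemma exp2_gt0 n : 0 < 2 ^+ n :> R. Proof. exact: exprn_gt0. Qed.

Lemma rep_set_ub a n k t :
  a%:V <=: (dyad n)%:V *+ k -> rep_set a t -> t <= k%:R / 2 ^+ n.
Proof.
move=> ak [m [l [-> la]]].
(* Both fractions are brought to the common denominator [2 ^ (m + n)]. *)
have Ee : (dyad (m + n))%:V *+ (l * 2 ^ n) = (dyad m)%:V *+ l.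
  by rewrite mulnC mulrnA dyad_shift.
have : (dyad (m + n))%:V *+ (l * 2 ^ n) <=: (dyad (m + n))%:V *+ (k * 2 ^ m).
  rewrite Ee addnC [(k * _)%N]mulnC mulrnA dyad_shift.
  exact: ext_le_trans la ak.
move/dyad_le_inj; rewrite Ee => /(_ (ext_le_fin la (@fin_neqN _ _))).
rewrite -(ler_nat R) !natrM !natrX.
by rewrite ler_pdivrMr ?exp2_gt0 // mulrAC ler_pdivlMr ?exp2_gt0.
Qed.

Lemma rep_ge a n k : (dyad n)%:V *+ k <=: a%:V -> k%:R / 2 ^+ n <= rep a.
Proof.
move=> H; apply: ub_le_sup; last by exists n, k.
exists (1%:R / 2 ^+ 0) => t; apply: rep_set_ub; exact: ext_le1.
Qed.

Lemma rep_le a n k : a%:V <=: (dyad n)%:V *+ k -> rep a <= k%:R / 2 ^+ n.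
Proof.
move=> H; apply: ge_sup; last by move=> t; exact: rep_set_ub.
by exists (0%:R / 2 ^+ 0), 0%N, 0%N; split=> //; exact: ext_le0.
Qed.

(** Descend from the upper bound [2 ^ n], using totality at each multiple of [dyad n]. *)
Lemma rep_approx a n : exists k,
  (dyad n)%:V *+ k <=: a%:V /\ a%:V <=: (dyad n)%:V *+ k.+1.
Proof.
have : a%:V <=: (dyad n)%:V *+ (2 ^ n) by rewrite dyad_muln; exact: ext_le1.
elim: (2 ^ n)%N => [|k IH].
  move=> H; exists 0%N; split; first exact: ext_le0.
  exact: ext_le_trans H (ext_le0 _).
by move=> H; have [/IH //|H'] := ext_total a%:V ((dyad n)%:V *+ k); exists k.
Qed.

Lemma rep_ge0 a : 0 <= rep a.
Proof. by have := @rep_ge a 0 0 (ext_le0 _); rewrite mul0r. Qed.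

Lemma rep_le1 a : rep a <= 1.
Proof. by have := @rep_le a 0 1 (ext_le1 _); rewrite divr1. Qed.

Lemma rep_one : rep one = 1.
Proof.
apply/eqP; rewrite eq_le rep_le1 /=.
by have := @rep_ge one 0 1 (ext_le_refl _); rewrite divr1.
Qed.

Lemma rep_add a b s : a%:V + b%:V = s%:V -> rep a + rep b = rep s.
Proof.
move=> e.
(* Each summand is known up to [1 / 2 ^ n], so both sides lie in one interval of length
   [2 / 2 ^ n]. *)
have bounds n : exists c : R,
    [/\ c <= rep a + rep b, rep a + rep b <= c + 2 / 2 ^+ n,
        c <= rep s & rep s <= c + 2 / 2 ^+ n].
  have [k [k1 k2]] := rep_approx a n; have [l [l1 l2]] := rep_approx b n.
  have s1 := rep_ge (_ : (dyad n)%:V *+ (k + l) <=: s%:V).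
  have s2 := rep_le (_ : s%:V <=: (dyad n)%:V *+ (k.+1 + l.+1)).
  rewrite -e mulrnDr in s1; have {}s1 := s1 (ext_le_add k1 l1).
  rewrite -e mulrnDr in s2; have {}s2 := s2 (ext_le_add k2 l2).
  move/rep_ge: k1 => k1; move/rep_ge: l1 => l1.
  move/rep_le: k2 => k2; move/rep_le: l2 => l2.
  exists ((k + l)%:R / 2 ^+ n); rewrite -mulrDl; move: s1 s2 k1 k2 l1 l2.
  by rewrite !natrD -!natr1 !mulrDl; split; lra.
apply/eqP; rewrite eq_le; apply/andP; split; apply: (@le_dyadic_eps _ 2) => n;
  by have [c [? ? ? ?]] := bounds n; lra.
Qed.

Lemma rep_zero : rep pcm0 = 0.
Proof.
apply/eqP; rewrite -[_ == _](inj_eq (addrI (rep pcm0))).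
by rewrite (@rep_add _ _ pcm0) ?addr0.
Qed.

Lemma rep_muln a b n : a%:V *+ n = b%:V -> rep b = n%:R * rep a.
Proof.
elim: n b => [|n IH] b; first by rewrite mulr0n mul0r => -[<-]; exact: rep_zero.
rewrite mulrS => e; have [_ [c [_ ec]]] := add_eq_fin e.
rewrite -natr1 mulrDl mul1r addrC -(IH c ec).
by apply/esym/rep_add; rewrite -ec.
Qed.

Lemma rep_mono a b : a%:V <=: b%:V -> rep a <= rep b.
Proof. by case/ext_le_finP => c /rep_add <-; rewrite lerDl rep_ge0. Qed.

(** If [k / 2 ^ n] approximates [a] from below, then [k] copies of [dyad n ** b] lie below [a ** b],
    each of value [rep b / 2 ^ n]. *)
Lemma rep_mul_ge a b : rep a * rep b <= rep (a ** b).
Proof.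
apply: (@le_dyadic_eps _ 1) => n.
have [k [k1 /rep_le k2]] := rep_approx a n.
have Eb := rep_muln (dyad_mul_muln n b).
have kab := additive_muln_le (em_additive_l b) k1.
have [c Ec] := extP (ext_le_fin kab (@fin_neqN _ _)).
have {kab} := kab; rewrite Ec => /rep_mono; rewrite (rep_muln Ec).
rewrite -natrX in k2 *.
have n0 : 0 < (2 ^ n)%:R :> R by rewrite ltr0n expn_gt0.
have -> : rep (dyad n ** b) = rep b / (2 ^ n)%:R.
  by rewrite Eb mulrC mulKf // gt_eqF.
move=> H; apply: (@le_trans _ _ (k.+1%:R / (2 ^ n)%:R * rep b)).
  by apply: ler_wpM2r => //; exact: rep_ge0.
rewrite -natr1 !mulrDl.
have -> : k%:R / (2 ^ n)%:R * rep b = k%:R * (rep b / (2 ^ n)%:R) by rewrite mulrAC mulrA.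
apply: lerD => //; apply: ler_piMr; last exact: rep_le1.
by rewrite mul1r invr_ge0 ltW.
Qed.

(** The lower bounds for [a] and for its complement [c] add up to [rep b], the exact total, so
    neither is strict. *)
Lemma rep_mul a b : rep (a ** b) = rep a * rep b.
Proof.
apply/eqP; rewrite eq_le rep_mul_ge andbT.
have [c Ec] := compl_exists a.
have := rep_mul_ge c b; have := rep_add (sem_mulDl b Ec).
rewrite em_1mul; have := rep_add Ec; rewrite rep_one => E1 E2.
have -> : rep c = 1 - rep a by rewrite -E1 addrC addKr.
by rewrite mulrBl mul1r; lra.
Qed.

(** Such an [a] is below every [dyad n], so all its multiples stay below [one]. *)
Lemma rep_eq0 a : rep a = 0 -> a = pcm0.
Proof.
move=> r0; apply: (@archimedean S (sem1 S) (@sem_axiom S) a) => n.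
have [H|H] := sem_total a (dyad n).
  have : a%:V *+ n <=: one%:V.
    rewrite -(dyad_muln n); apply: ext_le_trans (ext_le_muln n H) _.
    by apply: ext_le_mulnr; exact/ltnW/ltn_expl.
  by move/ext_le_fin; exact.
have := @rep_ge a n 1 H.
by rewrite r0 leNgt mul1r invr_gt0 exp2_gt0.
Qed.

Lemma rep_le_reflect a b : rep a <= rep b -> a%:V <=: b%:V.
Proof.
move=> H; have [//|ba] := sem_total a b.
have [c Ec] := ext_le_finP ba.
have : c = pcm0.
  apply: rep_eq0; apply/eqP; rewrite eq_le rep_ge0 andbT.
  by move: H; rewrite -(rep_add Ec) gerDl.
by move=> c0; rewrite -Ec c0 addr0; exact: ext_le_refl.
Qed.

Lemma rep_inj : injective rep.
Proof.
move=> a b e; apply: fin_inj; apply: (@ext_le_anti M);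
  by apply: rep_le_reflect; rewrite e.
Qed.

Lemma rep_perp a b : rep a + rep b <= 1 -> a%:V + b%:V <> None.
Proof.
have [c Ec] := compl_exists b; rewrite addrC -rep_one -(rep_add Ec) lerD2l.
move=> /rep_le_reflect H; apply: (@ext_le_fin _ _ one%:V) => //.
by rewrite -Ec addrC; apply: ext_le_add => //; exact: ext_le_refl.
Qed.

Lemma rep_surj (t : R) : 0 <= t <= 1 -> exists a, rep a = t.
Proof.
(* The value 1 is set apart so that [k n + 1 <= 2 ^ n] below, which keeps the upper approximations
   defined. *)
move=> /andP[t0]; rewrite le_eqVlt => /orP[/eqP ->|t1].
  by exists one; exact: rep_one.
pose k n := Num.truncn (t * 2 ^+ n).
have kP n : (k n)%:R <= t * 2 ^+ n < (k n).+1%:R.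
  by apply: truncn_itv; rewrite mulr_ge0 // ltW // exp2_gt0.
have k_lt n : (k n < 2 ^ n)%N.
  have /andP[H _] := kP n; rewrite -(ltr_nat R); apply: le_lt_trans H _.
  by rewrite natrX gtr_pMl // exp2_gt0.
have Hx n : exists b, (dyad n)%:V *+ k n = b%:V.
  by have [b Eb] := extP (dyad_fin (ltnW (k_lt n))); exists b.
have [x Ex] := choice Hx.
have x_le n : (x n)%:V <=: (x n.+1)%:V.
  rewrite -!Ex -(dyad_shift n 1) addn1 -mulrnA.
  apply: ext_le_mulnr; rewrite -ltnS -(ltr_nat R) expn1 natrM.
  have /andP[H1 _] := kP n; have /andP[_ H2] := kP n.+1.
  by apply: le_lt_trans H2; rewrite exprS mulrCA ler_pM2l.
have [a] := @chain_sup S (sem1 S) (@sem_axiom S) x x_le.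
have id_sigma : sigma_additive (id : S -> S) by [].
move=> /(_ _ id_sigma) [a1 a2]; exists a.
apply/eqP; rewrite eq_le; apply/andP; split; apply: (@le_dyadic_eps _ 1) => n.
(* [y] is the truncation of [t] rounded up; it bounds the whole chain, since
   [rep (x m) <= t <= rep y]. *)
- have [y Ey] := extP (dyad_fin (k_lt n)).
  have ay : a%:V <=: y%:V.
    apply: a2 => m; apply: rep_le_reflect.
    apply: (@le_trans _ _ t).
      have := @rep_le (x m) m (k m); rewrite Ex => /(_ (ext_le_refl _)) H.
      apply: le_trans H _; rewrite ler_pdivrMr ?exp2_gt0 //.
      by have /andP[] := kP m.
    have := @rep_ge y n (k n).+1; rewrite Ey => /(_ (ext_le_refl _)); apply: le_trans.
    rewrite ler_pdivlMr ?exp2_gt0 // ltW //.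
    by have /andP[] := kP n.
  have := @rep_le a n (k n).+1; rewrite Ey => /(_ ay) H; apply: le_trans H _.
  rewrite -natr1 mulrDl lerD2r ler_pdivrMr ?exp2_gt0 //.
  by have /andP[] := kP n.
- have := @rep_ge a n (k n); rewrite Ex => /(_ (a1 n)) H.
  have /andP[_ H2] := kP n.
  apply: (@le_trans _ _ ((k n).+1%:R / 2 ^+ n)).
    by rewrite ler_pdivlMr ?exp2_gt0 // ltW.
  by rewrite -natr1 mulrDl lerD2r.
Qed.

End Representation.

(** * Normalization *)

Lemma unit_em_iso (M : effectMonoid) :
  (ea1 : M) = pcm0 -> em_isomorphic M unit_em.
Proof.
move=> e.
have a0 (a : M) : a = pcm0.
  by apply: fin_inj; apply: ext_le_zero; rewrite -fin0 -e; exact: ext_le1.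
exists (fun=> tt), (fun=> pcm0); split=> [||a|[]] //; split=> //.
by split=> // x y s _; exact: pcm_add0.
Qed.

Lemma bool_em_iso (M : effectMonoid) :
  (ea1 : M) <> pcm0 -> (forall a : M, a = pcm0 \/ a = ea1) ->
  em_isomorphic M bool_em.
Proof.
move=> n0 H; pose f (a : M) : bool := `[< a = ea1 >].
have f0 : f pcm0 = false by apply/asboolP => /esym.
have f1 : f ea1 = true by apply/asboolP.
exists f, (fun b : bool => if b then ea1 else pcm0); split.
- split=> //; first split=> // x y s.
    case: (H x) => ->; case: (H y) => ->.
    + by rewrite pcm_add0 => -[<-]; rewrite f0.
    + by rewrite pcm_add0 => -[<-]; rewrite f0 f1.
    + by rewrite pcm_addC pcm_add0 => -[<-]; rewrite f0 f1.
    + move=> e; have := @perp_one M ea1; rewrite fin_add e.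
      by move=> /(_ (@fin_neqN _ s)).
  move=> a b; case: (H a) => ->; case: (H b) => ->;
    rewrite ?em_mul1 ?em_1mul ?f0 ?f1 //.
  by rewrite (em_additive_l _).1 f0.
- split=> //; first split=> //.
    move=> [] [] s //= [<-]; rewrite ?pcm_add0 //.
    by rewrite pcm_addC pcm_add0.
  move=> [] [] /=; rewrite ?em_mul1 ?em_1mul //.
  by rewrite (em_additive_l _).1.
- by move=> a; case: (H a) => ->; rewrite ?f0 ?f1.
- by case; rewrite ?f0 ?f1.
Qed.

Lemma unit_interval_em_iso (R : realType) (S : sigmaEffectMonoid) (q : sem_em S) :
  right_division (sem_em S) -> (ea1 : sem_em S) <> pcm0 ->
  q%:V *+ 2 = (ea1 : sem_em S)%:V ->
  em_isomorphic (sem_em S) (unit_interval_em R).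
Proof.
move=> div n0 q2.
pose r := rep R q.
have rP a : 0 <= r a <= 1 by rewrite (rep_ge0 R n0 q2) (rep_le1 R n0 q2).
have [g gP] := choice (fun t : unit_interval R => rep_surj div n0 q2 (valP t)).
pose f a : unit_interval R := exist _ (r a) (rP a).
have fK : cancel f g by move=> a; apply: (rep_inj div n0 q2 (R := R)); rewrite gP.
have gK : cancel g f by move=> t; apply: ui_inj; rewrite /= /r gP.
have fM : @em_morphism (sem_em S) (unit_interval_em R) f.
  split.
  - split; first by apply: ui_inj; exact: (rep_zero R div n0 q2).
    by move=> x y s /(rep_add R div n0 q2) e; apply/ui_addP.
  - by apply: ui_inj; exact: (rep_one R n0 q2).
  - by move=> a b; apply: ui_inj; exact: (rep_mul R div n0 q2).
have [fA f1 fm] := fM.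
exists f, g; split=> //; split.
- split; first by apply: (can_inj fK); rewrite gK fA.1.
  move=> x y s /ui_addP e.
  (* Additivity of the inverse also requires this sum to be defined, which [rep_perp] supplies. *)
  have [|t Et] := @extP _ ((g x)%:V + (g y)%:V).
    by apply: (rep_perp (R := R) div n0 q2); rewrite !gP e ui_le1.
  rewrite -fin_add Et; congr Some; apply: (can_inj fK); rewrite gK; apply: ui_inj.
  by have /ui_addP := fA.2 _ _ _ Et; rewrite !gK e.
- by apply: (can_inj fK); rewrite gK f1.
- by move=> a b; apply: (can_inj fK); rewrite gK fm !gK.
Qed.

Lemma right_division_trichotomy (R : realType) (S : sigmaEffectMonoid) :
  right_division (sem_em S) ->
  [\/ em_isomorphic (sem_em S) unit_em, em_isomorphic (sem_em S) bool_em
    | em_isomorphic (sem_em S) (unit_interval_em R)].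
Proof.
move=> div; have [/unit_em_iso|n0] := EM ((ea1 : sem_em S) = pcm0).
  by constructor 1.
have [//|H|[q q2]] := half_exists div.
- by constructor 2; exact: bool_em_iso.
- by constructor 3; exact: unit_interval_em_iso q2.
Qed.

(** * Substates of a sigma-effectus and their normalization *)

Section Effectus.
Variable C : sigmaEffectus.
Implicit Types A B D : C.
Local Notation I := (effI : C).
Local Notation "0" := (zero_mor _ _).

(** Its image under [sem_em] is convertible to [scalars C], so results on division transfer
    directly. *)
Definition scalars_sem : sigmaEffectMonoid :=
  @SigmaEffectMonoid (homPAM I I) (truth I) (@eff_ea C I) (fun a b => a \\o b)
    (fun a b c => Defs.compA a b c)
    (fun a => @pac_biadditive_l C _ _ _ a) (fun a => @pac_biadditive_r C _ _ _ a)
    (@scalar_mul1 C) (@scalar_1mul C).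

Local Notation "f %:H" := (@fin (homPAM _ _) f)
  (at level 2, left associativity, format "f %:H").

Lemma compDl A B D (f g s : mor B D) (h : mor A B) :
  f%:H + g%:H = s%:H -> (f \\o h)%:H + (g \\o h)%:H = (s \\o h)%:H.
Proof. exact: (additive_fin (sigma_additive_additive (@pac_biadditive_l C _ _ _ h))). Qed.

Lemma compDr A B D (f g s : mor A B) (h : mor B D) :
  f%:H + g%:H = s%:H -> (h \\o f)%:H + (h \\o g)%:H = (h \\o s)%:H.
Proof. exact: (additive_fin (sigma_additive_additive (@pac_biadditive_r C _ _ _ h))). Qed.

Lemma comp_mulnl A B D (f s : mor B D) (h : mor A B) n :
  f%:H *+ n = s%:H -> (f \\o h)%:H *+ n = (s \\o h)%:H.
Proof.
exact: (additive_muln (sigma_additive_additive (@pac_biadditive_l C _ _ _ h))).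
Qed.

Lemma comp_mulnr A B D (f s : mor A B) (h : mor B D) n :
  f%:H *+ n = s%:H -> (h \\o f)%:H *+ n = (h \\o s)%:H.
Proof.
exact: (additive_muln (sigma_additive_additive (@pac_biadditive_r C _ _ _ h))).
Qed.

Lemma comp0m A B D (h : mor A B) : zero_mor B D \\o h = 0.
Proof. exact: (sigma_additive_additive (@pac_biadditive_l C _ _ _ h)).1. Qed.

Lemma compm0 A B D (h : mor B D) : h \\o zero_mor A B = 0.
Proof. exact: (sigma_additive_additive (@pac_biadditive_r C _ _ _ h)).1. Qed.

Lemma hom_inj A B (f g : mor A B) : f%:H = g%:H -> f = g.
Proof. by case. Qed.

(** The predicate [truth (B i) \\o pproj B i] lies below truth on the coproduct; restrict along the
    coprojection. *)
Lemma truth_coproj (B : bool -> C) i : truth _ \\o coproj B i = truth (B i).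
Proof.
have [p Ep] := @compl_exists (predicates (coprod B)) (truth (B i) \\o pproj B i).
have := compDl (coproj B i) Ep; rewrite -Defs.compA pproj_coproj compm1 => E.
apply: hom_inj; apply: (@ext_le_anti (predicates (B i))); first exact: ext_le1.
by rewrite -E; exact: ext_le_addr.
Qed.

Lemma muln_defined A B (f : mor A B) (u : mor A I) n :
  (truth B \\o f)%:H *+ n = u%:H ->
  exists g, f%:H *+ n = g%:H /\ truth B \\o g = u.
Proof.
elim: n u => [|n IH] u; rewrite ?mulr0n ?mulrS => E.
  exists 0; split=> //; rewrite compm0; exact: hom_inj E.
have [_ [v [_ Ev]]] := add_eq_fin E.
have [g [Eg tg]] := IH _ Ev.
have [|h Eh] := @extP _ (f%:H + g%:H).
  apply: eff_perp; rewrite tg; change ((truth B \\o f)%:H + v%:H <> None).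
  by rewrite -Ev E.
exists h; rewrite Eg; split=> //; apply: hom_inj.
by rewrite -(compDr (truth B) Eh) tg -E Ev.
Qed.

Local Notation II := (coprod (fun _ : bool => I)).
Local Notation k1 := (coproj (fun _ : bool => I) true).
Local Notation k2 := (coproj (fun _ : bool => I) false).
Local Notation p1 := (pproj (fun _ : bool => I) true).

(** Untying turns a summable pair of scalars into a substate on I + I. *)
Lemma pair_exists (a b s : mor I I) : a%:H + b%:H = s%:H ->
  exists w : mor I II,
    [/\ (k1 \\o a)%:H + (k2 \\o b)%:H = w%:H, p1 \\o w = a & truth _ \\o w = s].
Proof.
move=> E; have [|w Ew] := @extP _ ((k1 \\o a)%:H + (k2 \\o b)%:H).
  apply: pac_untying; change (a%:H + b%:H <> None); by rewrite E.
exists w; split=> //; apply: hom_inj.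
  rewrite -(compDr p1 Ew) !Defs.compA pproj_coproj pproj_coproj0 //.
  by rewrite comp1m comp0m; exact: addr0.
by rewrite -(compDr (truth _) Ew) !Defs.compA !truth_coproj truth_I !comp1m.
Qed.

(** The quotient is the first component of the normalization of the substate with components [a] and
    [b]. Any other quotient [c] with complement [d] gives a state [u] normalizing the same
    substate. *)
Lemma normalization_division : admits_normalization C -> right_division (scalars C).
Proof.
move=> norm a s /ext_le_finP [b E] s0.
have [w [Ew w1 ws]] := pair_exists E.
have w0 : w <> 0 by move=> w0; apply: s0; rewrite -ws w0 compm0.
have [v [[vst wv] vu]] := norm _ w w0.
exists (p1 \\o v); split=> [|c Ec]; first by rewrite /= -Defs.compA -ws -wv.
have [d Ed] : exists d, c%:H + d%:H = (truth I)%:H.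
  exact: (@compl_exists (scalars C) c).
have [u [Eu u1 ut]] := pair_exists Ed.
suff -> : v = u by [].
apply: vu; split=> //.
have Es : a%:H + (d \\o s)%:H = s%:H.
  by rewrite -[a]Ec [LHS](compDl s Ed) truth_I comp1m.
have db : d \\o s = b.
  by apply: hom_inj; apply: (@ext_addI (scalars C) a%:H); rewrite [LHS]Es.
rewrite ws; apply: hom_inj; rewrite -(compDl s Eu) -!Defs.compA -Ew db.
by rewrite (_ : c \\o s = a).
Qed.

Lemma unit_normalization : em_isomorphic (scalars C) unit_em -> admits_normalization C.
Proof.
move=> [f [g [_ _ fK _]]] A w []; apply: eff_zero.
by rewrite -(fK (truth A \\o w)) -(fK 0); case: (f _); case: (f _).
Qed.

(** A nonzero substate has weight 1, so it is its own normalization. *)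
Lemma bool_normalization : em_isomorphic (scalars C) bool_em -> admits_normalization C.
Proof.
move=> [f [g [[fa f1 _] _ fK _]]] A w w0.
have w1 : truth A \\o w = truth I.
  apply: (can_inj fK); rewrite f1.
  case E : (f _) => //; case: w0; apply: eff_zero; apply: (can_inj fK).
  by rewrite E fa.1.
exists w; split; first by rewrite /is_state w1 truth_I compm1.
by move=> v [_ ->]; rewrite w1 truth_I compm1.
Qed.

Lemma unit_interval_normalization (R : realType) :
  em_isomorphic (scalars C) (unit_interval_em R) -> admits_normalization C.
Proof.
move=> [f [g [[fA _ _] [[g0 gD] g1 gM] fK gK]]] A w w0.
pose s := f (truth A \\o w).
have sn0 : sval s != 0%R.
  apply/eqP => s0; apply: w0; apply: eff_zero; apply: (can_inj fK).
  by rewrite [RHS]fA.1; apply: ui_inj.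
have s_gt0 : (0 < sval s)%R by rewrite lt_neqAle eq_sym sn0 ui_ge0.
(* [N] exceeds [1 / s], so that [t = 1 / (N s)] lies in the unit interval. *)
pose N := (Num.truncn (sval s)^-1).+1.
have /truncn_itv/andP[_ Ns] : (0 <= (sval s)^-1)%R by rewrite invr_ge0 ui_ge0.
have N0 : (0 < N%:R :> R)%R by rewrite ltr0n.
have tP : (0 <= (N%:R * sval s)^-1 <= 1)%R.
  have Ns0 : (0 < N%:R * sval s)%R by rewrite mulr_gt0.
  rewrite invr_ge0 (ltW Ns0) invf_le1 // -ler_pdivrMr // mul1r.
  exact: ltW.
pose t : unit_interval R := exist (fun x : R => 0 <= x <= 1)%R _ tP.
have muln_g n (x : unit_interval R) y : (n%:R * sval x = sval y)%R ->
    (g x)%:H *+ n = (g y)%:H.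
  elim: n y => [|n IH] y e.
    rewrite mulr0n -[LHS]/(zero_mor I I)%:H -[zero_mor _ _]g0.
    by congr (g _)%:H; apply: ui_inj; rewrite -e mul0r.
  have zP : (0 <= n%:R * sval x <= 1)%R.
    rewrite mulr_ge0 ?ui_ge0 //= (le_trans _ (ui_le1 y)) // -e.
    by rewrite ler_wpM2r ?ui_ge0 // ler_nat.
  rewrite mulrS (IH (exist (fun x : R => 0 <= x <= 1)%R _ zP)) //.
  apply: gD; apply/ui_addP.
  by rewrite /= -e -natr1 mulrDl mul1r addrC.
have gs : truth A \\o w = g s by rewrite fK.
have st : (g (ui_mul s t))%:H *+ N = (truth I)%:H.
  rewrite -[truth I]g1; apply: muln_g => /=.
  by field; rewrite sn0 gt_eqF.
have gst : g s \\o g t = g (ui_mul s t) by rewrite [RHS]gM.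
have gts : g t \\o g s = g (ui_mul s t).
  by rewrite -[LHS](gM t s); congr g; apply: ui_inj; rewrite /= mulrC.
(* The weight of [w \\o g t] is [s t = 1 / N], so its [N]-fold sum is defined and is a state. *)
have [|v [Ev tv]] := @muln_defined I A (w \\o g t) (truth I) N.
  by rewrite Defs.compA gs gst.
exists v; split.
  split=> //; rewrite gs; apply: hom_inj.
  rewrite -(comp_mulnl (g s) Ev) -Defs.compA gts (comp_mulnr w st).
  by rewrite truth_I compm1.
(* Substituting [w = v' \\o g s] into the [N]-fold sum gives back [v']. *)
move=> v' [_ Ew]; apply: hom_inj.
rewrite -Ev Ew -Defs.compA gs gst (comp_mulnr v' st).
by rewrite truth_I compm1.
Qed.

End Effectus.

Theorem theorem44 (R : realType) (C : sigmaEffectus) :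
  admits_normalization C <->
  [\/ em_isomorphic (scalars C) unit_em,
      em_isomorphic (scalars C) bool_em
    | em_isomorphic (scalars C) (unit_interval_em R)].
Proof.
split=> [/normalization_division|[]].
- exact: (@right_division_trichotomy R (scalars_sem C)).
- exact: unit_normalization.
- exact: bool_normalization.
- exact: unit_interval_normalization.
Qed.
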